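(* Every uncapacitated flow-based extension (or, equivalently, every $s$--$t$ path extension) of the perfect matching polytope $P_{\mathrm{perfect\ matching}}(K_n)$ of the complete graph $K_n$, $n$ even, has size $\Omega\left(\frac{2^{\frac{n}{2}}}{\sqrt{n}}\right)$. That is, there is an absolute constant $C>0$ such that for all sufficiently large even integers $n$, every such extension has size at least $C\,\frac{2^{n/2}}{\sqrt{n}}$.
   Context: Perfect matching polytope: a perfect matching of an undirected graph $G=(V(G),E(G))$ is a set of edges $M\subseteq E(G)$ such that every vertex of $G$ is incident to exactly one edge of $M$. $P_{\mathrm{perfect\ matching}}(G)=\operatorname{conv}\{\chi^M\in\mathbb{R}^{E(G)} : M \text{ perfect matching of } G\}$, where $\chi^M$ is the incidence (0/1 characteristic) vector of $M$. Networks and flows: an uncapacitated network $N=(V,A)$ is a finite directed graph (parallel arcs allowed) with a source $s\in V$ and a sink $t\in V\setminus\{s\}$. For $v\in V$, $\delta^+(v)$ and $\delta^-(v)$ denote the sets of arcs leaving and entering $v$, and $\phi(B):=\sum_{a\in B}\phi_a$ for $\phi\in\mathbb{R}^A$, $B\subseteq A$. For a flow value $k>0$, the (uncapacitated) flow polyhedron is $$Q=\{\phi\in\mathbb{R}^A : \phi(\delta^+(v))-\phi(\delta^-(v))=0\ \forall v\in V\setminus\{s,t\},\ \phi(\delta^+(s))-\phi(\delta^-(s))=k,\ \phi\geqslant 0\}.$$ $Q$ is an uncapacitated flow-based extension of a polytope $P\subseteq\mathbb{R}^d$ if there is a linear map $\pi:\mathbb{R}^A\to\mathbb{R}^d$ with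 $\pi(Q)=P$. Its size is the number of arcs $|A|$ of the network. If $N$ is acyclic and $k=1$, then $Q$ is the convex hull of the characteristic vectors $\chi^\sigma\in\mathbb{R}^A$ of the directed $s$--$t$ paths $\sigma$ in $N$; in this case the extension is called an $s$--$t$ path extension. *)

(* Defs.v *)
From HB Require Import structures.
From mathcomp Require Import all_boot all_order all_algebra.
From mathcomp Require Import classical_sets reals convex.

Set Implicit Arguments.
Unset Strict Implicit.
Unset Printing Implicit Defensive.

Import Order.TTheory GRing.Theory Num.Theory.

Local Open Scope ring_scope.
Local Open Scope classical_set_scope.

(* R^I is {ffun I -> R^o}; the regular module R^o (convertible to R) gives it
   its lmodType structure. *)
Definition conv_hull (R : numDomainType) (V : lmodType R) (X : set V) : set V :=
  smallest (@convex_set R V) X.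

Record graph := Graph {
  vertex : finType;
  edge_set : {set {set vertex}};
  edge_card : forall e, e \in edge_set -> #|e| = 2%N
}.

Definition edge (G : graph) : finType := {e : {set vertex G} | e \in edge_set G}.

Lemma complete_graph_subproof (n : nat) (e : {set 'I_n}) :
  e \in [set e : {set 'I_n} | #|e| == 2%N]%SET -> #|e| = 2%N.
Proof. by rewrite inE => /eqP. Qed.

Definition complete_graph (n : nat) : graph :=
  Graph (@complete_graph_subproof n).

Definition perfect_matching (G : graph) (M : {set edge G}) : Prop :=
  forall v : vertex G, #|[set e in M | v \in val e]%SET| = 1%N.

Definition incidence_vector (R : realType) (I : finType) (B : {set I}) :
  {ffun I -> R^o} := [ffun i => (i \in B)%:R].

Definition perfect_matching_polytope (R : realType) (G : graph) :
    set {ffun edge G -> R^o} :=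
  conv_hull [set incidence_vector R M | M in @perfect_matching G].

Arguments perfect_matching_polytope R G _ : clear implicits.

Record network := Network {
  node : finType;
  arc : finType;
  tail : arc -> node;
  head : arc -> node;
  source : node;
  sink : node;
  sink_neq_source : sink != source
}.

Definition arcs_out (N : network) (v : node N) : {set arc N} :=
  [set a | tail a == v]%SET.

Definition arcs_in (N : network) (v : node N) : {set arc N} :=
  [set a | head a == v]%SET.

Definition net_outflow (R : realType) (N : network)
    (phi : {ffun arc N -> R^o}) (v : node N) : R :=
  \sum_(a in arcs_out v) phi a - \sum_(a in arcs_in v) phi a.

Definition flow_polyhedron (R : realType) (N : network) (k : R) :
    set {ffun arc N -> R^o} :=
  [set phi | [/\ forall v, v != source N -> v != sink N -> net_outflow phi v = 0,
                 net_outflow phi (source N) = k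
               & forall a, 0 <= phi a :> R]].

Arguments flow_polyhedron {R} N k _.

(* No nonempty closed directed walk, given as its cyclic sequence of arcs. *)
Definition acyclic (N : network) : Prop :=
  forall c : seq (arc N),
    cycle (fun a b : arc N => head a == tail b) c -> c = [::].

Definition extension_with_value (R : realType) (N : network) (k : R)
    (I : finType) (P : set {ffun I -> R^o}) : Prop :=
  exists pi : {linear {ffun arc N -> R^o} -> {ffun I -> R^o}},
    pi @` flow_polyhedron N k = P.

Arguments extension_with_value {R} N k {I} P.

Definition flow_based_extension (R : realType) (N : network)
    (I : finType) (P : set {ffun I -> R^o}) : Prop :=
  exists2 k : R, 0 < k & extension_with_value N k P.

Definition path_extension (R : realType) (N : network)
    (I : finType) (P : set {ffun I -> R^o}) : Prop :=
  acyclic N /\ extension_with_value N (1 : R) P.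

Definition extension_size (N : network) : nat := #|arc N|.

Arguments flow_based_extension {R} N {I} P.
Arguments path_extension {R} N {I} P.

(* Main.v *)
(** Write n = 2m and consider only the matchings M_s joining x_i to y_(s i), for
    a permutation s of m elements.  Every s-t walk is sent to a point of the
    polytope, so each coordinate has nonnegative cost on all s-t walks and, after
    subtracting shortest-path potentials, nonnegative cost on every useful arc.
    Each vertex u of K_n has degree 1 in all these points, so the degree of u
    collected so far depends only on the node v reached: call it D u v, from 0 at
    the source to 1 at the sink.  Some walk in the support of a flow above M_s
    uses no edge outside M_s, whence D x v = D (s x) v along it.  Let A v be the
    set of x with D x v > 0; it grows along the walk, and some arc a of the walk
    is the one where #|A| crosses h = m/2.  On a set K of size h between
    A (tail a) and A (head a), the image s(K) is determined by a: on A (tail a)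
    by the degrees, on the rest by the support of the cost of a.  Hence each arc
    serves at most h! (m-h)! permutations, and there are at least 'C(m, h) arcs. *)
Require Import Defs.
From mathcomp Require Import all_boot all_order all_algebra.
From mathcomp Require Import fingroup perm action.
From mathcomp Require Import classical_sets reals boolp convex interval_inference.
From mathcomp Require Import zify ring lra.
From mathcomp Require Import fintype finset.
Import Defs.

Set Implicit Arguments.
Unset Strict Implicit.
Unset Printing Implicit Defensive.

Import Order.TTheory GRing.Theory Num.Theory.
Local Open Scope ring_scope.

(** * Finite sets, permutations and central binomial coefficients *)

Lemma subset_of_card_between (T : finType) (A B : {set T}) (h : nat) :
  A \subset B -> (#|A| <= h <= #|B|)%N ->
  exists K : {set T}, [/\ A \subset K, K \subset B & #|K| = h].
Proof.
move=> AB /andP[Ah hB].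
elim: h Ah hB => [|h IH] Ah hB.
  by exists A; split => //; apply/eqP; rewrite -leqn0.
case: (leqP #|A| h) => [Ah'|hA]; last first.
  by exists A; split => //; apply/eqP; rewrite eqn_leq Ah.
have [K [AK KB Kh]] := IH Ah' (ltnW hB).
have /subsetPn[x xB xK] : ~~ (B \subset K).
  by apply: contraTN hB => /subset_leq_card; rewrite Kh -leqNgt.
exists (x |: K)%SET; split.
- exact: (subset_trans AK (subsetUr _ _)).
- by rewrite subUset sub1set xB.
- by rewrite cardsU1 xK Kh.
Qed.

(** Composing with the inverse of one such permutation [s0] yields permutations stabilising [K], and
    these are determined by their restrictions to [K] and to its complement. *)
Lemma card_perm_imset (T : finType) (K L : {set T}) :
  (#|[set s : {perm T} | s @: K == L]%SET| <= (#|K|)`! * (#|T| - #|K|)`!)%N.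
Proof.
set S := [set s | _]%SET.
have [->|[s0 /[!inE]/eqP s0K]] := set_0Vmem S; first by rewrite cards0.
have nK s : s \in S -> (s * s0^-1)%g \in 'N(K | 'P)%g.
  rewrite inE => /eqP sK; apply/astabsP => x; rewrite /= apermE permM.
  by rewrite -(mem_imset _ _ (@perm_inj _ s0)) permKV s0K -sK mem_imset //; apply: perm_inj.
have nKC s : s \in S -> (s * s0^-1)%g \in 'N(~: K | 'P)%g.
  by move=> /nK; rewrite astabsC.
pose f (s : {perm T}) : {perm T} * {perm T} :=
  (restr_perm K (s * s0^-1)%g, restr_perm (~: K) (s * s0^-1)%g).
have -> : (#|T| - #|K| = #|~: K|)%N by rewrite -(cardsC K) addKn.
rewrite -!card_Sym -cardsX.
have finj : {in S &, injective f}.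
  move=> s1 s2 s1S s2S [e1 e2]; apply: (mulIg s0^-1%g); apply/permP => x.
  have [xK|xK] := boolP (x \in K).
    by rewrite -(restr_permE (nK _ s1S) xK) -(restr_permE (nK _ s2S) xK) e1.
  have xK' : x \in ~: K by rewrite inE.
  by rewrite -(restr_permE (nKC _ s1S) xK') -(restr_permE (nKC _ s2S) xK') e2.
rewrite -(card_in_imset finj); apply/subset_leq_card/subsetP => _ /imsetP[s _ ->].
by rewrite !inE; apply/andP; split; apply: restr_perm_on.
Qed.

(** Squared form of 'C(N, N/2) >= 2^N / (2 sqrt N). Even rows go by induction; the middle
    coefficient of an odd row is half the central one of the next row. *)
Lemma central_bin_lower (N : nat) : (0 < N)%N -> (4 ^ N <= 'C(N, N./2) ^ 2 * (4 * N))%N.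
Proof.
have sub1 m : 'C(m.*2.+1, m.+1) = 'C(m.*2.+1, m).
  rewrite -bin_sub; last by lia.
  by congr 'C(_, _); lia.
have rec m : (m.+1 * 'C(m.+1.*2, m.+1) = 2 * (m.*2.+1) * 'C(m.*2, m))%N.
  have := mul_bin_diag m.+1.*2 m; rewrite doubleS /= => <-.
  have := mul_bin_diag m.*2.+1 m => /=.
  rewrite sub1; nia.
have odd_ m : ('C(m.*2.+1, m) * 2 = 'C(m.+1.*2, m.+1))%N.
  by rewrite doubleS binS sub1 muln2 addnn.
have ev m : (0 < m)%N -> (16 ^ m <= 'C(m.*2, m) ^ 2 * (4 * m))%N.
  elim: m => // -[_ _|m IH _]; first by [].
  have {}IH := IH isT; have := rec m.+1.
  set c' := 'C(m.+2.*2, m.+2); set c := 'C(m.+1.*2, m.+1) in IH *.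
  rewrite expnS; move: (16 ^ m.+1)%N c' c IH => q c' c IH E.
  rewrite -(leq_pmul2l (isT : 0 < m.+2)%N).
  have -> : (m.+2 * (c' ^ 2 * (4 * m.+2)) = 4 * (m.+2 * c') ^ 2)%N by rewrite !expnS; nia.
  (* Everything reduces to 4(m+1)(m+2) <= (2m+3)^2. *)
  rewrite E; apply: (@leq_trans (16 * m.+2 * (c ^ 2 * (4 * m.+1)))%N).
    by rewrite mulnCA mulnA leq_mul2l IH orbT.
  have -> : (2 * m.+1.*2.+1 * c = 2 * (2 * m + 3) * c)%N by congr (_ * _ * _)%N; lia.
  by rewrite !expnS; nia.
move=> N0; case: (boolP (odd N)) => oN.
  have EN : N = N./2.*2.+1 by rewrite -[LHS]odd_double_half oN.
  have := odd_ N./2; have := ev N./2.+1 isT; rewrite -EN; set c := 'C(N, _); set c' := 'C(_, _).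
  move=> h1 h2; have E4 : (4 * 4 ^ N = 16 ^ N./2.+1)%N.
    by rewrite -expnS (_ : 16 = 4 ^ 2)%N // -expnM {1}EN; congr (_ ^ _)%N; lia.
  move: h1; rewrite -E4 -h2 !expnS; nia.
have EN : N = N./2.*2 by rewrite -[LHS]odd_double_half (negbTE oN).
have : (0 < N./2)%N by lia.
move=> /ev; rewrite -EN.
rewrite (_ : 16 = 4 ^ 2)%N // -expnM mul2n -EN => /leq_trans; apply; nia.
Qed.

(** * Walks in a network *)

(** Nodes and arcs may repeat, since the network of a flow-based extension may contain cycles. *)
Fixpoint walk (N : network) (v : node N) (p : seq (arc N)) (w : node N) : bool :=
  if p is a :: p' then (tail a == v) && walk (head a) p' w else v == w.

Lemma walk_cat (N : network) (u v w : node N) (p q : seq (arc N)) :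
  walk u p v -> walk v q w -> walk u (p ++ q) w.
Proof.
elim: p u => [u /eqP -> //|a p IH u /= /andP[-> pv] qw].
exact: IH.
Qed.

Lemma walk_rcons (N : network) (v : node N) (p : seq (arc N)) (a : arc N) :
  walk v p (tail a) -> walk v (rcons p a) (head a).
Proof. by move=> pa; rewrite -cats1; apply: (walk_cat pa); rewrite /= !eqxx. Qed.

Lemma walk_split (N : network) (v w : node N) (p : seq (arc N)) (a : arc N) :
  walk v p w -> a \in p ->
  (exists q, walk v q (tail a)) /\ (exists q, walk (head a) q w).
Proof.
elim: p v => // b p IH v /= /andP[bv pw]; rewrite inE => /predU1P[->|ap].
  by split; [exists [::]; rewrite /= eq_sym|exists p].
have [[q qa] ?] := IH _ pw ap; split=> //.
by exists (b :: q); rewrite /= bv.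
Qed.

Lemma walk_invariant (N : network) (P : node N -> Prop) (v w : node N)
    (p : seq (arc N)) :
  walk v p w -> P v -> {in p, forall a, P (tail a) -> P (head a)} ->
  {in p, forall a, P (tail a) /\ P (head a)}.
Proof.
elim: p v => // b p IH v /= /andP[/eqP bv pw] Pv Pp a.
have Pb : P (head b) by apply: Pp; rewrite ?mem_head ?bv.
rewrite inE => /predU1P[->|]; first by rewrite bv.
apply: IH pw Pb _ _ => c cp; apply: Pp.
by rewrite inE cp orbT.
Qed.

Lemma walk_crossing (N : network) (f : node N -> nat) (h : nat) (v w : node N)
    (p : seq (arc N)) :
  walk v p w -> (f v < h <= f w)%N ->
  exists2 a, a \in p & (f (tail a) < h <= f (head a))%N.
Proof.
elim: p v => [v /eqP -> |b p IH v /= /andP[/eqP <- pw]] /andP[vh hw].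
  by move: (leq_trans vh hw); rewrite ltnn.
have [hb|bh] := leqP h (f (head b)).
  by exists b; rewrite ?mem_head ?vh.
have [|a ap ha] := IH _ pw; first by rewrite bh.
by exists a; rewrite ?inE ?ap ?orbT.
Qed.

Lemma walk_telescope (R : zmodType) (N : network) (m : node N -> R)
    (v w : node N) (p : seq (arc N)) :
  walk v p w -> \sum_(a <- p) (m (tail a) - m (head a)) = m v - m w.
Proof.
elim: p v => [v /eqP -> |b p IH v /= /andP[/eqP <- pw]].
  by rewrite big_nil subrr.
by rewrite big_cons (IH _ pw) addrA subrK.
Qed.

(** * Costs and potentials *)

(** These are the arcs on source-sink walks, the ones whose costs are controlled by hypotheses on
    such walks. *)
Definition useful (N : network) (a : arc N) : Prop :=
  (exists p, walk (source N) p (tail a)) /\ (exists q, walk (head a) q (sink N)).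

Lemma walk_useful (N : network) (p : seq (arc N)) :
  walk (source N) p (sink N) -> {in p, forall a, useful a}.
Proof. by move=> wp a ap; apply: walk_split wp ap. Qed.

(* The potential of a node is its distance from the source. *)
Lemma nonneg_reduced_cost (R : realType) (N : network) (c : arc N -> R)
    (p0 : seq (arc N)) :
  (forall p, walk (source N) p (sink N) -> 0 <= \sum_(a <- p) c a) ->
  walk (source N) p0 (sink N) -> \sum_(a <- p0) c a = 0 ->
  exists m : node N -> R,
    [/\ m (source N) = 0, m (sink N) = 0 &
        forall a, useful a -> 0 <= c a + (m (tail a) - m (head a))].
Proof.
move=> c0 wp0 p00.
pose S v : set R := [set r | exists2 p, walk (source N) p v & r = \sum_(a <- p) c a]%classic.
pose m v := inf (S v).
(* Completing any walk to [v] by a fixed walk [q] to the sink gives nonnegative total cost, so the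
   infimum is finite. *)
have lbS v q : walk v q (sink N) -> lbound (S v) (- \sum_(a <- q) c a).
  move=> wq _ [p wp ->]; rewrite -subr_ge0 opprK -big_cat.
  exact: c0 (walk_cat wp wq).
have m_le v p q : walk (source N) p v -> walk v q (sink N) -> m v <= \sum_(a <- p) c a.
  move=> wp wq; apply: ge_inf; last by exists p.
  by exists (- \sum_(a <- q) c a); apply: lbS.
have m_red a : useful a -> 0 <= c a + (m (tail a) - m (head a)).
  move=> [[p wp] [q wq]].
  rewrite addrA subr_ge0 -lerBlDl.
  apply: lb_le_inf; first by exists (\sum_(b <- p) c b); exists p.
  move=> _ [r wr ->]; rewrite lerBlDl.
  have := m_le _ _ _ (walk_rcons wr) wq.
  by rewrite -cats1 big_cat big_seq1 addrC.
have mt0 : 0 <= m (sink N).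
  apply: lb_le_inf; first by exists (\sum_(b <- p0) c b); exists p0.
  by move=> _ [p wp ->]; apply: c0.
have ms0 : m (source N) <= 0.
  by rewrite -[0](big_nil _ +%R predT c); apply: m_le wp0; rewrite /=.
(* Telescoping along the zero-cost walk gives [m (sink N) <= m (source N)]; with [mt0] and [ms0]
   both values are 0. *)
have : 0 <= \sum_(a <- p0) (c a + (m (tail a) - m (head a))).
  by rewrite big_seq; apply: sumr_ge0 => a ap; apply/m_red/(walk_useful wp0).
rewrite big_split /= (walk_telescope _ wp0) p00 add0r => mst.
by exists m; split=> //; lra.
Qed.

(** All walks to a node have the same cost, because one continuation to the sink completes each of
    them to total 1. [D] is this common cost. *)
Lemma exact_potential (R : realType) (N : network) (c : arc N -> R) (p0 : seq (arc N)) :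
  (forall p, walk (source N) p (sink N) -> \sum_(a <- p) c a = 1) ->
  walk (source N) p0 (sink N) ->
  exists D : node N -> R,
    [/\ D (source N) = 0, D (sink N) = 1 &
        forall a, useful a -> c a = D (head a) - D (tail a)].
Proof.
move=> c1 wp0.
(* The default 0 occurs only at nodes unreachable from the source, hence at no end of a useful
   arc. *)
pose D v := xget 0 [set r | exists2 p, walk (source N) p v & r = \sum_(a <- p) c a]%classic.
have DE v p q : walk (source N) p v -> walk v q (sink N) -> D v = \sum_(a <- p) c a.
  move=> wp wq; rewrite /D; case: xgetP => [_ _ [p' wp' ->]|/(_ (\sum_(a <- p) c a)) []].
    apply: (addIr (\sum_(a <- q) c a)).
    by rewrite -!big_cat !c1 //; apply: walk_cat wq.
  by exists p.
exists D; split.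
- by rewrite (@DE _ [::] p0) ?big_nil //=.
- by rewrite (@DE _ p0 [::]) ?c1 //=.
- move=> a [[p wp] [q wq]].
  rewrite (DE _ _ _ (walk_rcons wp) wq) (@DE (tail a) p (a :: q)) //=; last by rewrite eqxx.
  by rewrite -cats1 big_cat big_seq1 addrAC subrr add0r.
Qed.

(** * Flows along walks, and walks in the support of a flow *)

Definition unit_flow (R : realType) (N : network) (a : arc N) : {ffun arc N -> R^o} :=
  [ffun b => (b == a)%:R].

(** Arcs count with multiplicity: each traversal carries [k]. *)
Definition walk_flow (R : realType) (N : network) (k : R) (p : seq (arc N)) :
    {ffun arc N -> R^o} :=
  \sum_(a <- p) k *: unit_flow R a.

Lemma net_outflowE (R : realType) (N : network) (phi : {ffun arc N -> R^o}) (v : node N) :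
  net_outflow phi v = \sum_a (phi a : R) * ((tail a == v)%:R - (head a == v)%:R).
Proof.
rewrite /net_outflow big_mkcond [X in _ - X]big_mkcond -sumrB.
apply: eq_bigr => a _; rewrite !inE mulrBr.
by do 2 case: eqP => _; rewrite ?mulr1 ?mulr0.
Qed.

Lemma net_outflow_linear (R : realType) (N : network) (x : R)
    (phi psi : {ffun arc N -> R^o}) (v : node N) :
  net_outflow (x *: phi + psi) v = x * net_outflow phi v + net_outflow psi v.
Proof.
rewrite !net_outflowE mulr_sumr -big_split /=; apply: eq_bigr => a _.
by rewrite !ffunE mulrDl mulrA.
Qed.

Lemma net_outflow_unit (R : realType) (N : network) (a : arc N) (v : node N) :
  net_outflow (unit_flow R a) v = (tail a == v)%:R - (head a == v)%:R.
Proof.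
rewrite net_outflowE (bigD1 a) //= big1 ?addr0 => [|b /negbTE ba].
  by rewrite ffunE eqxx mul1r.
by rewrite ffunE ba mul0r.
Qed.

Lemma net_outflow_walk (R : realType) (N : network) (k : R) (u v w : node N)
    (p : seq (arc N)) :
  walk u p w -> net_outflow (walk_flow k p) v = k * ((u == v)%:R - (w == v)%:R).
Proof.
rewrite /walk_flow; elim: p u => [u /eqP -> |b p IH u /= /andP[/eqP <- pw]].
  rewrite big_nil subrr mulr0 net_outflowE big1 // => a _.
  by rewrite ffunE mul0r.
by rewrite big_cons net_outflow_linear net_outflow_unit (IH _ pw); ring.
Qed.

Lemma walk_flow_ge0 (R : realType) (N : network) (k : R) (p : seq (arc N)) (a : arc N) :
  0 <= k -> 0 <= (walk_flow k p a : R).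
Proof.
move=> k0; rewrite /walk_flow sum_ffunE; apply: sumr_ge0 => b _.
by rewrite !ffunE; apply: mulr_ge0.
Qed.

Lemma walk_flow_notin (R : realType) (N : network) (k : R) (p : seq (arc N)) (a : arc N) :
  a \notin p -> (walk_flow k p a : R) = 0.
Proof.
move=> ap; rewrite /walk_flow sum_ffunE big_seq big1 // => b bp.
rewrite !ffunE; case: eqP => [ab|_]; last exact: mulr0.
by rewrite ab bp in ap.
Qed.

Lemma walk_flow_in (R : realType) (N : network) (k : R) (p : seq (arc N)) :
  0 <= k -> walk (source N) p (sink N) -> flow_polyhedron N k (walk_flow k p).
Proof.
move=> k0 wp; split.
- move=> v /negbTE vs /negbTE vt; rewrite (net_outflow_walk _ _ wp).
  by rewrite eq_sym vs eq_sym vt subrr mulr0.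
- by rewrite (net_outflow_walk _ _ wp) eqxx (negbTE (sink_neq_source N)) subr0 mulr1.
- by move=> a; apply: walk_flow_ge0.
Qed.

(* Otherwise the set X of nodes reached from the source along positive arcs
   misses the sink, so its total net outflow is k, yet no flow leaves X. *)
Lemma support_walk (R : realType) (N : network) (k : R) (phi : {ffun arc N -> R^o}) :
  0 < k -> flow_polyhedron N k phi ->
  exists2 p, walk (source N) p (sink N) & {in p, forall a, 0 < (phi a : R)}.
Proof.
move=> k0 [cons out ge0]; apply: contrapT => no_walk.
pose X v := `[< exists2 p, walk (source N) p v & {in p, forall a, 0 < (phi a : R)} >].
have Xs : X (source N) by apply/asboolP; exists [::]; rewrite /=.
have Xt : ~~ X (sink N) by apply/asboolP.
have Xstep a : 0 < (phi a : R) -> X (tail a) -> X (head a).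
  move=> pa /asboolP[p wp pp]; apply/asboolP; exists (rcons p a); first exact: walk_rcons.
  by move=> b; rewrite mem_rcons inE => /predU1P[->|/pp].
have : \sum_(v | X v) net_outflow phi v = k.
  rewrite (bigD1 (source N)) //= big1 ?addr0 // => v /andP[Xv vs].
  by apply: cons => //; apply: contraNneq Xt => <-.
have sumX w : \sum_(v | X v) (w == v)%:R = (X w)%:R :> R.
  case: (boolP (X w)) => Xw.
    rewrite (bigD1 w) //= eqxx big1 ?addr0 // => v /andP[_ /negbTE].
    by rewrite eq_sym => ->.
  by rewrite big1 // => v Xv; case: eqP Xw => // ->; rewrite Xv.
under eq_bigr do rewrite net_outflowE.
rewrite exchange_big /= => /eqP; apply/negP; rewrite lt_eqF // (le_lt_trans _ k0) //.
apply: sumr_le0 => a _; rewrite -mulr_sumr sumrB !sumX.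
have := ge0 a; rewrite le_eqVlt => /predU1P[<-|pa]; first by rewrite mul0r.
rewrite pmulr_rle0 // subr_le0 ler_nat.
by case: (X (tail a)) (Xstep a pa) => // ->.
Qed.

Lemma scale_below (R : realFieldType) (A : finType) (f g : A -> R) :
  (forall a, 0 <= f a) -> (forall a, 0 <= g a) -> (forall a, g a = 0 -> f a = 0) ->
  exists2 d : R, 0 < d < 1 & forall a, d * f a <= g a.
Proof.
move=> f0 g0 fg; set S := \sum_a f a / g a.
have fg0 a : 0 <= f a / g a by apply: divr_ge0.
have S0 : 0 <= S by apply: sumr_ge0.
have S2 : 0 < 2 + S by apply: ltr_wpDr.
(* [S] bounds every ratio [f a / g a], and the summand 2 keeps the inverse below 1. *)
exists (2 + S)^-1; first by rewrite invr_gt0 S2 invf_lt1 //=; lra.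
move=> a; rewrite mulrC ler_pdivrMr //.
have [/fg ->|ga] := eqVneq (g a) 0; first by rewrite mulr_ge0 // ltW.
have aS : f a / g a <= S by rewrite /S (bigD1 a) //= lerDl sumr_ge0.
have -> : f a = g a * (f a / g a) by rewrite mulrC divfK.
by apply: ler_wpM2l => //; lra.
Qed.

(* A small multiple of the walk can be split off [phi]; both summands are mapped
   to points of [P], which is nonnegative. *)
Lemma extension_walk (R : realType) (N : network) (k : R) (I : finType)
    (P : set {ffun I -> R^o})
    (pi : {linear {ffun arc N -> R^o} -> {ffun I -> R^o}}) (x : {ffun I -> R^o}) :
  0 < k -> (pi @` flow_polyhedron N k)%classic = P ->
  (forall y i, P y -> 0 <= (y i : R)) -> P x ->
  exists2 p, walk (source N) p (sink N) &
    forall i, (x i : R) = 0 -> (pi (walk_flow k p) i : R) = 0.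
Proof.
move=> k0 piP P0; rewrite -{1}piP => -[phi phiQ <-].
have [p wp pp] := support_walk k0 phiQ; exists p => // i xi.
have [cons out ge0] := phiQ; have k0' := ltW k0.
have [|||d /andP[d0 d1] dle] := @scale_below R _ (walk_flow k p) phi.
- by move=> a; apply: walk_flow_ge0.
- by [].
- move=> a pa; apply: walk_flow_notin; apply/negP => /pp.
  by rewrite pa ltxx.
have d1' : 1 - d != 0 by rewrite subr_eq0 eq_sym lt_eqF.
(* The remainder after removing [d] times the walk flow, rescaled to have value [k] again. *)
pose psi := (1 - d)^-1 *: (- d *: walk_flow k p + phi).
have psiE v : net_outflow psi v =
    (1 - d)^-1 * (- d * net_outflow (walk_flow k p) v + net_outflow phi v).
  rewrite /psi -[X in net_outflow X]addr0 net_outflow_linear net_outflow_linear.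
  rewrite [X in _ + X](_ : _ = 0) ?addr0 // net_outflowE big1 // => a _.
  by rewrite ffunE mul0r.
have [wcons wout _] := walk_flow_in k0' wp.
have psiQ : flow_polyhedron N k psi.
  split.
  - by move=> v vs vt; rewrite psiE wcons // cons // !mulr0 addr0 mulr0.
  - by rewrite psiE wout out; field.
  - move=> a; rewrite /psi !ffunE; apply: mulr_ge0.
      by rewrite invr_ge0 subr_ge0 ltW.
    by change (0 <= - d * walk_flow k p a + phi a :> R); rewrite mulNr addrC subr_ge0.
have psi0 : 0 <= (pi psi i : R) by apply: P0; rewrite -piP; exists psi.
have w0 : 0 <= (pi (walk_flow k p) i : R).
  by apply: P0; rewrite -piP; exists (walk_flow k p); first exact: walk_flow_in.
(* A convex combination: where the image of [phi] vanishes, both nonnegative summands vanish. *)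
have phiE : phi = (1 - d) *: psi + d *: walk_flow k p.
  by rewrite /psi scalerA divff // scale1r scaleNr addrAC addNr add0r.
clear psiE psiQ; clearbody psi; move: xi; rewrite phiE linearD !linearZ !ffunE => /eqP.
rewrite paddr_eq0 ?mulr_ge0 ?subr_ge0 ?(ltW d0) ?(ltW d1) // => /andP[_].
by rewrite mulf_eq0 (gt_eqF d0) => /eqP.
Qed.

(** * Inequalities valid on the perfect matching polytope *)

(** A half-space is convex, and the hull is the smallest convex set containing [X]. *)
Lemma conv_hull_halfspace (R : realType) (V : lmodType R) (X : set V)
    (l : V -> R) (b : R) :
  (forall t x y, l (t *: x + y) = t * l x + l y) ->
  (forall x, X x -> b <= l x) -> forall x, conv_hull X x -> b <= l x.
Proof.
move=> lin Xb x; apply: (smallest_sub (X := [set x | b <= l x]%classic)); last exact: Xb.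
move=> y z t /set_mem /= yb /set_mem /= zb; apply/mem_set => /=.
have l0 : l 0 = 0 by have := lin 1 0 0; rewrite scale1r addr0 mul1r; lra.
have lZ s u : l (s *: u) = s * l u by rewrite -[s *: u]addr0 lin l0 addr0.
rewrite /conv /= lin lZ.
have t0 : 0 <= t%:num by [].
have t1 : t%:num <= 1 by [].
rewrite /unstable.onem.
have : t%:num * (l y - b) + (1 - t%:num) * (l z - b) >= 0.
  by apply: addr_ge0; apply: mulr_ge0; rewrite ?subr_ge0.
lra.
Qed.

Lemma perfect_matching_polytope_ge0 (R : realType) (G : graph)
    (x : {ffun edge G -> R^o}) (e : edge G) :
  perfect_matching_polytope R G x -> 0 <= (x e : R).
Proof.
apply: (conv_hull_halfspace (l := fun x : {ffun edge G -> R^o} => x e : R)).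
  by move=> t y z; rewrite !ffunE.
by move=> _ [M _ <-]; rewrite ffunE.
Qed.

(** The equation is a pair of half-spaces, given by [deg] and its negation. *)
Lemma perfect_matching_polytope_degree (R : realType) (G : graph)
    (x : {ffun edge G -> R^o}) (v : vertex G) :
  perfect_matching_polytope R G x -> \sum_(e : edge G | v \in val e) (x e : R) = 1.
Proof.
pose deg (y : {ffun edge G -> R^o}) := \sum_(e : edge G | v \in val e) (y e : R).
have lin t y z : deg (t *: y + z) = t * deg y + deg z.
  by rewrite /deg mulr_sumr -big_split /=; apply: eq_bigr => e _; rewrite !ffunE.
have deg1 M : perfect_matching M -> deg (incidence_vector R M) = 1.
  move=> /(_ v) pM; rewrite /deg.
  under eq_bigr do rewrite ffunE.
  rewrite -natr_sum -[RHS]/(1%:R) -pM -sum1_card; congr (_%:R).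
  rewrite big_mkcond [RHS]big_mkcond; apply: eq_bigr => e _; rewrite inE.
  by case: (e \in M); case: (v \in _).
move=> Px; apply/le_anti/andP; split.
  rewrite -[X in _ <= X]opprK -[X in X <= _]opprK lerN2.
  apply: (conv_hull_halfspace (l := fun y => - deg y) _ _ Px).
    by move=> t y z; rewrite lin opprD mulrN.
  by move=> _ [M pM <-]; rewrite deg1.
apply: (conv_hull_halfspace lin _ Px).
by move=> _ [M pM <-]; rewrite deg1.
Qed.

(** * Counting the permutations served by an arc *)

(* [c a x y] stands for the reduced cost of [a] on the edge x-y; [A v] and [B v]
   for the vertices on either side already of positive degree at [v]. *)
Definition arc_compatible (R : realType) (N : network) (m : nat)
    (h : nat) (A B : node N -> {set 'I_m}) (c : arc N -> 'I_m -> 'I_m -> R) (a : arc N)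
    (s : 'S_m) : Prop :=
  [/\ (#|A (tail a)| < h <= #|A (head a)|)%N,
      A (tail a) \subset A (head a),
      forall x, (s x \in B (tail a)) = (x \in A (tail a)),
      {in A (head a) :\: A (tail a), forall x, 0 < c a x (s x)}
    & forall x y, y != s x -> c a x y = 0].

(* Choose K of size h between the two node sets of [a]; on K, every compatible
   permutation has the same image. *)
Lemma arc_compatible_imset (R : realType) (N : network) (m : nat) (h : nat)
    (A B : node N -> {set 'I_m}) (c : arc N -> 'I_m -> 'I_m -> R) (a : arc N) :
  exists K L : {set 'I_m}, forall s, arc_compatible h A B c a s ->
    #|K| = h /\ s @: K = L.
Proof.
have [[s0 [/andP[/ltnW Ah hA] AA _ _ _]]|none] :=
    pselect (exists s, arc_compatible h A B c a s); last first.
  by exists set0, set0 => s cs; case: none; exists s.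
have [|K [AK KA Kh]] := @subset_of_card_between _ _ _ h AA; first by rewrite Ah.
(* This image depends on [a] and [K] only, not on [s]. *)
exists K, (B (tail a) :|: [set y | [exists x in K :\: A (tail a), 0 < c a x y]])%SET.
move=> s [_ _ sAB cpos czero]; split=> //; apply/setP => y; rewrite !inE.
apply/imsetP/orP => [[x xK ->]|[yB|/existsP[x]]].
- rewrite sAB; have [xA|xA] := boolP (x \in A (tail a)); first by left.
  right; apply/existsP; exists x; rewrite inE xA xK /=.
  by apply: cpos; rewrite inE xA (subsetP KA).
- exists (s^-1%g y); last by rewrite permKV.
  by rewrite (subsetP AK) // -sAB permKV.
- rewrite inE => /andP[/andP[_ xK] cxy]; exists x => //.
  by apply/eqP; apply: contraLR cxy => /czero ->; rewrite ltxx.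
Qed.

(** Assign to each permutation a compatible arc. The fibres partition m! permutations and have at
    most h! (m-h)! elements each. *)
Lemma binomial_le_arcs (R : realType) (N : network) (m h : nat) (A B : node N -> {set 'I_m})
    (c : arc N -> 'I_m -> 'I_m -> R) :
  (h <= m)%N -> (forall s : 'S_m, exists a, arc_compatible h A B c a s) ->
  ('C(m, h) <= #|arc N|)%N.
Proof.
move=> hm /choice[f fP].
have fact_gt0 : (0 < h`! * (m - h)`!)%N by rewrite muln_gt0 !fact_gt0.
rewrite -(leq_pmul2r fact_gt0) bin_fact // -card_Sn -sum1_card.
rewrite (partition_big f xpredT) //= -sum_nat_const; apply: leq_sum => a _.
have [K [L KL]] := arc_compatible_imset h A B c a.
rewrite sum1dep_card.
have [->|[s0 /[!inE]/eqP fs0]] := set_0Vmem [set s | f s == a]%SET; first by rewrite cards0.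
have [Kh _] : #|K| = h /\ s0 @: K = L by apply: KL; rewrite -fs0; apply: fP.
have := card_perm_imset K L; rewrite card_ord Kh; apply: leq_trans.
apply/subset_leq_card/subsetP => s; rewrite !inE => /eqP fs.
by apply/eqP; have [] : #|K| = h /\ s @: K = L by apply: KL; rewrite -fs; apply: fP.
Qed.

(** The core argument, in terms of arc costs alone: [inc u] is the set of edges at [u], and [ed x y]
    joins the two sides. [E] may also contain edges inside a side. *)
Lemma matching_walks_arcs (R : realType) (N : network) (E : finType) (m h : nat)
    (c : arc N -> E -> R) (inc : 'I_m + 'I_m -> {set E}) (ed : 'I_m -> 'I_m -> E) :
  (1 < m)%N -> (0 < h <= m)%N ->
  (forall u x y, (ed x y \in inc u) = (u == inl x) || (u == inr y)) ->
  (forall p e, walk (source N) p (sink N) -> 0 <= \sum_(a <- p) c a e) ->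
  (forall p u, walk (source N) p (sink N) ->
     \sum_(a <- p) \sum_(e in inc u) c a e = 1) ->
  (forall s : 'S_m, exists2 p, walk (source N) p (sink N) &
     forall e, (forall x, e != ed x (s x)) -> \sum_(a <- p) c a e = 0) ->
  ('C(m, h) <= #|arc N|)%N.
Proof.
move=> m1 /andP[h0 hm] incE c_ge0 c_deg c_walk.
have ed_inj x y x' y' : ed x y = ed x' y' -> x = x' /\ y = y'.
  move=> eq_ed.
  have : ed x y \in inc (inl x') by rewrite eq_ed incE eqxx.
  have : ed x y \in inc (inr y') by rewrite eq_ed incE eqxx orbT.
  by rewrite !incE orbF => /eqP[->] /eqP[->].
(* Some permutation avoids [e]: for [e = ed x y], one sending [x] to another [y'], which exists as
   [m > 1]. *)
have c_zero e : exists2 p, walk (source N) p (sink N) & \sum_(a <- p) c a e = 0.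
  have [/existsP[x /existsP[y /eqP ->]]|nee] := boolP [exists x, exists y, e == ed x y].
    have [y' yy'] : exists y', y' != y.
      have [->|] := eqVneq y (Ordinal m1); last by exists (Ordinal m1); rewrite eq_sym.
      by exists (Ordinal (ltnW m1)).
    have [p wp p0] := c_walk (tperm x y'); exists p => //; apply: p0 => x'.
    apply/eqP => /ed_inj[<-]; rewrite tpermL => yE.
    by rewrite yE eqxx in yy'.
  have [p wp p0] := c_walk 1%g; exists p => //; apply: p0 => x.
  by apply: contraNneq nee => ->; apply/existsP; exists x; apply/existsP; exists ((1%g : 'S_m) x).
have /choice[mu muP] e : exists mu : node N -> R,
    [/\ mu (source N) = 0, mu (sink N) = 0 &
        forall a, useful a -> 0 <= c a e + (mu (tail a) - mu (head a))].
  have [p wp p0] := c_zero e.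
  exact: (nonneg_reduced_cost (fun p => c_ge0 p e) wp p0).
(* Reduced costs: nonnegative on useful arcs, with unchanged totals on source-sink walks. *)
pose c' a e := c a e + (mu e (tail a) - mu e (head a)).
have c'_ge0 a e : useful a -> 0 <= c' a e by have [_ _] := muP e; apply.
have c'_sum p e : walk (source N) p (sink N) -> \sum_(a <- p) c' a e = \sum_(a <- p) c a e.
  move=> wp; rewrite big_split /= (walk_telescope _ wp).
  by have [-> -> _] := muP e; rewrite subrr addr0.
(* Reduced costs at [u] still total 1 on every source-sink walk, so they derive from a potential,
   the degree collected at [u]. *)
have /choice[D DP] u : exists D : node N -> R,
    [/\ D (source N) = 0, D (sink N) = 1 &
        forall a, useful a -> \sum_(e in inc u) c' a e = D (head a) - D (tail a)].
  have [p wp _] := c_walk 1%g; apply: exact_potential wp => q wq.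
  rewrite exchange_big /= -[RHS](c_deg q u wq) [RHS]exchange_big /=.
  by apply: eq_bigr => e _; apply: c'_sum.
pose A v := [set x | 0 < D (inl x) v]%SET.
pose B v := [set y | 0 < D (inr y) v]%SET.
apply: (@binomial_le_arcs R N m h A B (fun a x y => c' a (ed x y))) => // s.
have [p wp p0] := c_walk s.
have useful_p := walk_useful wp.
(* Nonnegative terms with sum zero vanish one by one. *)
have c'_0 a e : a \in p -> (forall x, e != ed x (s x)) -> c' a e = 0.
  move=> ap es; have := p0 e es; rewrite -c'_sum // => /eqP.
  rewrite big_seq psumr_eq0 => [|b bp]; last exact/c'_ge0/useful_p.
  by move=> /allP/(_ a ap)/implyP/(_ ap)/eqP.
(* Along the walk of [s], only the edge between [x] and [s x] contributes at either end, so both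
   degrees grow in step. *)
have deg_l a x : a \in p -> D (inl x) (head a) = D (inl x) (tail a) + c' a (ed x (s x)).
  move=> ap; have [_ _ /(_ a (useful_p a ap))] := DP (inl x).
  rewrite (bigD1 (ed x (s x))) ?incE ?eqxx //= big1 => [|e /andP[ex es]]; first by lra.
  apply: c'_0 => // x'; apply/eqP => ee; move: ex es; rewrite ee incE /= orbF => /eqP[->].
  by rewrite eqxx.
have deg_r a x : a \in p -> D (inr (s x)) (head a) = D (inr (s x)) (tail a) + c' a (ed x (s x)).
  move=> ap; have [_ _ /(_ a (useful_p a ap))] := DP (inr (s x)).
  rewrite (bigD1 (ed x (s x))) ?incE ?eqxx ?orbT //= big1 => [|e /andP[ex es]]; first by lra.
  apply: c'_0 => // x'; apply/eqP => ee; move: ex es; rewrite ee incE /= => /eqP[/perm_inj->].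
  by rewrite eqxx.
have Dge0 x := walk_invariant (P := fun v => 0 <= D (inl x) v) wp.
have Deq x := walk_invariant (P := fun v => D (inr (s x)) v = D (inl x) v) wp.
have Ds u : D u (source N) = 0 by have [] := DP u.
(* [A] is empty at the source and full at the sink. *)
have [|a ap ha] := walk_crossing (f := fun v => #|A v|) (h := h) wp.
  have -> : A (source N) = set0 by apply/setP => x; rewrite !inE Ds ltxx.
  have -> : A (sink N) = setT.
    by apply/setP => x; rewrite !inE; have [_ -> _] := DP (inl x); rewrite ltr01.
  by rewrite cards0 cardsT card_ord h0.
have c'a_ge0 e : 0 <= c' a e by apply/c'_ge0/useful_p.
have D0 x : 0 <= D (inl x) (tail a).
  case: (Dge0 x _ _ a ap) => //; first by rewrite Ds.
  by move=> b bp Db; rewrite deg_l // addr_ge0 // c'_ge0 //; apply: useful_p.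
exists a; split=> //.
- by apply/subsetP => x; rewrite !inE deg_l // => Dx; rewrite ltr_wpDr.
- move=> x; rewrite !inE; case: (Deq x _ _ a ap) => [||-> //]; first by rewrite !Ds.
  by move=> b bp Db; rewrite deg_l // deg_r // Db.
- move=> x; rewrite !inE -leNgt deg_l // => /andP[Dx].
  by have := D0 x; lra.
- move=> x y ys; apply: c'_0 => // x'; apply: contraNneq ys => /ed_inj[-> ->]; exact: eqxx.
Qed.

(** * Matchings between the two halves of the complete graph *)

Lemma incidence_vector_in_polytope (R : realType) (G : graph) (M : {set edge G}) :
  perfect_matching M -> perfect_matching_polytope R G (incidence_vector R M).
Proof. by move=> pM; apply: (sub_smallest (fun _ => id)); exists M. Qed.

Lemma crossing_edge_subproof (m : nat) (x y : 'I_m) :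
  [set lshift m x; rshift m y]%SET \in edge_set (complete_graph (m + m)).
Proof. by rewrite inE cards2 eq_lrshift. Qed.

Definition crossing_edge (m : nat) (x y : 'I_m) : edge (complete_graph (m + m)) :=
  exist (fun e => e \in edge_set _) _ (crossing_edge_subproof x y).

Definition star (m : nat) (u : 'I_m + 'I_m) : {set edge (complete_graph (m + m))} :=
  [set e : edge (complete_graph (m + m)) | unsplit u \in val e]%SET.

Lemma crossing_edge_star (m : nat) (u : 'I_m + 'I_m) (x y : 'I_m) :
  (crossing_edge x y \in star u) = (u == inl x) || (u == inr y).
Proof.
rewrite inE /= !inE.
by case: u => z; rewrite /= ?eq_lshift ?eq_rshift ?eq_lrshift ?eq_rlshift ?orbF.
Qed.

Lemma crossing_perfect_matching (m : nat) (s : 'S_m) :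
  perfect_matching [set e : edge (complete_graph (m + m)) |
    [exists x, e == crossing_edge x (s x)]]%SET.
Proof.
(* [x] indexes the matching edge at [v]: the index of [v] on the left side, its preimage under [s]
   on the right. *)
move=> v; pose x := match split v with inl x => x | inr y => (s^-1 y)%g end.
rewrite -(cards1 (crossing_edge x (s x))); apply: eq_card => e.
rewrite !inE; apply/andP/eqP => [[/existsP[x' /eqP ->]]|->].
  have := crossing_edge_star (split v) x' (s x'); rewrite inE splitK => ->.
  rewrite /x; case: (split v) => z /=.
    by rewrite orbF => /eqP[->].
  by move=> /eqP[->]; rewrite permK.
split; first by apply/existsP; exists x.
have := crossing_edge_star (split v) x (s x); rewrite inE splitK => ->.
by rewrite /x; case: (split v) => z /=; rewrite ?permKV eqxx ?orbT.
Qed.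

(** * The bound on the size of an extension *)

Lemma binomial_le_extension_size (R : realType) (N : network) (k : R) (m h : nat) :
  0 < k -> (1 < m)%N -> (0 < h <= m)%N ->
  extension_with_value N k (perfect_matching_polytope R (complete_graph (m + m))) ->
  ('C(m, h) <= #|arc N|)%N.
Proof.
move=> k0 m1 hm [pi piP].
(* By linearity, the cost of a walk on [e] is coordinate [e] of the image of its walk flow. *)
pose c a e : R := pi (k *: unit_flow R a) e.
have cE p e : \sum_(a <- p) c a e = pi (walk_flow k p) e.
  by rewrite /walk_flow linear_sum sum_ffunE.
have walkP p : walk (source N) p (sink N) ->
    perfect_matching_polytope R (complete_graph (m + m)) (pi (walk_flow k p)).
  by move=> wp; rewrite -piP; exists (walk_flow k p) => //; apply: walk_flow_in => //; apply: ltW.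
apply: (matching_walks_arcs (c := c) m1 hm (@crossing_edge_star m)).
- by move=> p e wp; rewrite cE; apply: perfect_matching_polytope_ge0; apply: walkP.
- move=> p u wp; rewrite exchange_big /=.
  rewrite -(perfect_matching_polytope_degree (unsplit u : vertex (complete_graph _)) (walkP p wp)).
  by apply: eq_big => [e|e _]; rewrite ?inE ?cE.
- move=> s.
  have Ps := incidence_vector_in_polytope (R := R) (crossing_perfect_matching s).
  have [p wp p0] := extension_walk k0 piP (fun x e => @perfect_matching_polytope_ge0 R _ x e) Ps.
  exists p => // e es; rewrite cE; apply: p0; rewrite ffunE inE.
  by case: existsP => // -[x /eqP ex]; have := es x; rewrite ex eqxx.
Qed.

Theorem theorem7 (R : realType) :
  exists2 C : R, 0 < C &
  exists n0 : nat, forall n : nat, (n0 <= n)%N -> ~~ odd n ->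
  forall N : network,
    (flow_based_extension N (perfect_matching_polytope R (complete_graph n)) ->
       C * (2%:R ^+ n./2 / Num.sqrt n%:R) <= (extension_size N)%:R)
    /\
    (path_extension N (perfect_matching_polytope R (complete_graph n)) ->
       C * (2%:R ^+ n./2 / Num.sqrt n%:R) <= (extension_size N)%:R).
Proof.
(* The constant 1/2 comes from the factor 4 in [central_bin_lower]; [n >= 4] ensures [m > 1]. *)
exists 2^-1 => //; exists 4%N => n n4 n_even N.
suff bound (k : R) : 0 < k ->
    extension_with_value N k (perfect_matching_polytope R (complete_graph n)) ->
    2^-1 * (2%:R ^+ n./2 / Num.sqrt n%:R) <= (extension_size N)%:R :> R.
  by split=> [[k k0]|[_]]; apply: bound.
have [m {n_even}nE] : exists m, n = (m + m)%N.
  by exists n./2; rewrite addnn even_halfK.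
have -> : n./2 = m by rewrite nE addnn doubleK.
subst n => k0 ext.
have m1 : (1 < m)%N by lia.
have m0 : (0 < m)%N by lia.
have := binomial_le_extension_size (h := m./2) k0 m1 _ ext.
have -> : (0 < m./2 <= m)%N by lia.
move=> /(_ isT) arcs; apply: le_trans (_ : 'C(m, m./2)%:R <= _); last by rewrite ler_nat.
have s0 : 0 < Num.sqrt (m + m)%:R :> R by rewrite sqrtr_gt0 ltr0n addn_gt0 m0.
(* Squared, the goal is 4^m / 4 <= 2m 'C(m, m/2)^2, while [central_bin_lower] gives 4^m / 4 <= m
   'C(m, m/2)^2. *)
rewrite mulrA ler_pdivrMr // -(@ler_pXn2r _ 2) ?nnegrE ?mulr_ge0 ?exprn_ge0 ?(ltW s0) //.
rewrite !exprMn sqr_sqrtr ?ler0n // -exprM mulnC exprM.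
have := central_bin_lower m0.
rewrite -(ler_nat R) natrX natrM natrX natrM natrD.
rewrite (_ : 2 ^+ 2 = 4 :> R); last by ring.
have : 0 <= 'C(m, m./2)%:R ^+ 2 * m%:R :> R by rewrite mulr_ge0 ?exprn_ge0.
by lra.
Qed.
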